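(* Let $R$ be a commutative unital ring and $A\in \mathbb{M}_{2}(R)$. Then $A$ has left stable range 1 in $\mathbb{M}_2(R)$ if and only if $A$ has right stable range 1 in $\mathbb{M}_2(R)$.
   Context: Let $S$ be a unital ring with group of units $U(S)$. An element $a\in S$ has left stable range 1 if whenever $Sa+Sb=S$ for some $b\in S$, there is $y\in S$ such that $a+yb\in U(S)$. Symmetrically, $a$ has right stable range 1 if whenever $aS+bS=S$ for some $b\in S$, there is $y\in S$ such that $a+by\in U(S)$. $\mathbb{M}_2(R)$ is the ring of $2\times 2$ matrices over $R$. *)

(* Defs.v *)
From HB Require Import structures.
From mathcomp Require Import all_boot all_order all_algebra.
Set Implicit Arguments.
Unset Strict Implicit.
Unset Printing Implicit Defensive.
Import GRing.Theory.
Local Open Scope ring_scope.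

(* [pzRingType] is the structure of unital rings, the zero ring
   included. Invertibility is a Prop: [GRing.unit] is only available on a
   [unitRingType], where it is a decidable predicate. *)
Definition is_unit (S : pzRingType) (u : S) : Prop :=
  exists v : S, u * v = 1 /\ v * u = 1.

Definition left_ideals_span (S : pzRingType) (a b : S) : Prop :=
  forall x : S, exists s t : S, x = s * a + t * b.

Definition right_ideals_span (S : pzRingType) (a b : S) : Prop :=
  forall x : S, exists s t : S, x = a * s + b * t.

Definition left_stable_range1 (S : pzRingType) (a : S) : Prop :=
  forall b : S, left_ideals_span a b -> exists y : S, is_unit (a + y * b).

Definition right_stable_range1 (S : pzRingType) (a : S) : Prop :=
  forall b : S, right_ideals_span a b -> exists y : S, is_unit (a + b * y).

(* Main.v *)
Require Import Defs.
From HB Require Import structures.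
From mathcomp Require Import all_boot all_order all_algebra.
From mathcomp Require Import ring.
Set Implicit Arguments.
Unset Strict Implicit.
Unset Printing Implicit Defensive.
Import GRing.Theory.
Local Open Scope ring_scope.

(** For [2 x 2] matrices over a commutative ring the two conditions are
    controlled by one and the same determinant. In any ring, [a] has left stable
    range 1 exactly when every [x] admits a [y] making [a + y * (1 - x * a)]
    invertible, because the test elements [b] can be taken of the form
    [1 - x * a]; symmetrically on the right with [a + (1 - a * x) * y]. For
    [2 x 2] matrices these two elements, built from the same [x] and [y], have
    the same determinant ([det_stable_range_mx2]), and a matrix is invertible as
    soon as its determinant is ([is_unit_mx]). So the same [y] serves for both
    sides. *)

(** When [s * a + t * b = 1], the element [1 - s * a] is the left multiple
    [t * b] of [b], so a [y] completing [a] along [1 - s * a] gives [y * t]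
    completing it along [b]. *)
Lemma left_stable_range1P (S : pzRingType) (a : S) :
  left_stable_range1 a <->
  forall x : S, exists y : S, is_unit (a + y * (1 - x * a)).
Proof.
split=> [lsr_a x | sr_a b /(_ 1)[s [t e1]]].
  by apply: lsr_a => z; exists (z * x), z; rewrite mulrBr mulrA mulr1 subrKC.
have [y uy] := sr_a s; exists (y * t).
by rewrite -mulrA; move: uy; rewrite {1}e1 addrAC subrr add0r.
Qed.

Lemma right_stable_range1P (S : pzRingType) (a : S) :
  right_stable_range1 a <->
  forall x : S, exists y : S, is_unit (a + (1 - a * x) * y).
Proof.
split=> [rsr_a x | sr_a b /(_ 1)[s [t e1]]].
  by apply: rsr_a => z; exists (x * z), z; rewrite mulrBl mulrA mul1r subrKC.
have [y uy] := sr_a s; exists (t * y).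
by rewrite mulrA; move: uy; rewrite {1}e1 addrAC subrr add0r.
Qed.

(** The inverse of [M] is its adjugate divided by the determinant. *)
Lemma is_unit_mx (R : comPzRingType) n (M : 'M[R]_n) :
  is_unit M <-> is_unit (\det M).
Proof.
split=> [[N [MN1 NM1]] | [v [dv1 vd1]]].
  by exists (\det N); split; rewrite -det_mulmx mulmxE (MN1, NM1) [LHS]det1.
exists (v *: \adj M); split.
  by rewrite -mulmxE -scalemxAr mul_mx_adj scale_scalar_mx vd1.
by rewrite -mulmxE -scalemxAl mul_adj_mx scale_scalar_mx vd1.
Qed.

(** The determinant of a [2 x 2] matrix is a quadratic form, with polar form
    [(P, Q) |-> \tr (\adj P *m Q)]. *)
Lemma det_addmx2 (R : comPzRingType) (P Q : 'M[R]_2) :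
  \det (P + Q) = \det P + \tr (\adj P *m Q) + \det Q.
Proof.
have lift0 (i : 'I_1) : lift 0 i = 1 :> 'I_2 by rewrite ord1; apply: val_inj.
have lift1 (i : 'I_1) : lift 1 i = 0 :> 'I_2 by rewrite ord1; apply: val_inj.
rewrite /mxtrace !(expand_det_row _ 0) !big_ord_recl !big_ord0 !mxE.
rewrite !big_ord_recl !big_ord0 !mxE /cofactor !det_mx11 !mxE !lift0 !lift1 /=.
ring.
Qed.

(** The case [n = 2] of Sylvester's identity. *)
Lemma det_1sub_mulmxC (R : comPzRingType) (X A : 'M[R]_2) :
  \det (1%:M - X *m A) = \det (1%:M - A *m X).
Proof.
rewrite !det_addmx2 adj1 !mul1mx !raddfN /= (mxtrace_mulC X).
by rewrite -!scaleN1r !detZ !det_mulmx (mulrC (\det X)).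
Qed.

(** Expanding both sides with [det_addmx2], the terms quadratic in [Y] agree by
    [det_1sub_mulmxC]. In the polar terms [\adj A] meets [A] (after a cyclic
    permutation under the trace, on the left-hand side), leaving
    [\tr (\adj A *m Y) - \det A * \tr (X *m Y)] on both sides. *)
Lemma det_stable_range_mx2 (R : comPzRingType) (A X Y : 'M[R]_2) :
  \det (A + Y *m (1%:M - X *m A)) = \det (A + (1%:M - A *m X) *m Y).
Proof.
have polar : \tr (\adj A *m (Y *m (1%:M - X *m A)))
           = \tr (\adj A *m ((1%:M - A *m X) *m Y)).
  rewrite mulmxBr mulmxBl mulmx1 mul1mx !mulmxBr !raddfB /=; congr (_ - _).
  rewrite -mulmxA [in RHS]mulmxA mul_adj_mx mxtrace_mulC -!mulmxA mul_mx_adj.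
  rewrite mulmxA mxtrace_mulC !mul_scalar_mx !mxtraceZ.
  by rewrite mxtrace_mulC.
by rewrite !det_addmx2 polar !det_mulmx det_1sub_mulmxC (mulrC (\det Y)).
Qed.

Theorem corollary6 (R : comPzRingType) (A : 'M[R]_2) :
  left_stable_range1 A <-> right_stable_range1 A.
Proof.
have unitC (X Y : 'M[R]_2) :
    is_unit (A + Y * (1 - X * A)) <-> is_unit (A + (1 - A * X) * Y).
  rewrite !is_unit_mx; move: (det_stable_range_mx2 A X Y).
  by rewrite !mulmxE => ->.
rewrite left_stable_range1P right_stable_range1P.
by split=> sr X; have [Y /unitC uY] := sr X; exists Y.
Qed.
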